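(* Let $(W_n)_\phi$ be any signed wheel with the hub vertex as the sink. Then for $n\ge 3$ we have $$\mathcal{K}((W_n)_\phi)\cong\begin{cases}\mathbb{Z}_{f_n}\oplus\mathbb{Z}_{5f_n}, & n\text{ is odd and }(W_n)_\phi\text{ is unbalanced},\\ \mathbb{Z}_{\ell_n}\oplus\mathbb{Z}_{\ell_n}, & n\text{ is even and }(W_n)_\phi\text{ is unbalanced},\\ \mathbb{Z}_{\ell_n}\oplus\mathbb{Z}_{\ell_n}, & n\text{ is odd and }(W_n)_\phi\text{ is balanced},\\ \mathbb{Z}_{f_n}\oplus\mathbb{Z}_{5f_n}, & n\text{ is even and }(W_n)_\phi\text{ is balanced},\end{cases}$$ and this gives all possible critical groups of $(W_n)_\phi$.
   Context: A signed graph $G_\phi$ is a simple graph $G=(V,E)$ together with a sign function $\phi:E\to\{+,-\}$; $|G|$ denotes the signed graph on $G$ with all edges positive. Switching a vertex $v$ of $G_\phi$ means reversing the sign of every edge incident to $v$; two signed graphs with the same underlying graph are switching equivalent if one is obtained from the other by a sequence of vertex switchings. A signed graph $G_\phi$ is balanced if it is switching equivalent to the all-positive graph $|G|$, and unbalanced otherwise. For $n\ge3$, the wheel $W_n$ is the graph on $n+1$ vertices obtained by joining a hub vertex $q$ to all vertices $v_1,\dots,v_n$ of an $n$-cycle; a signed wheel $(W_n)_\phi$ is a signed graph with underlying graph $W_n$, and the hub $q$ is taken as the sink. The reduced signed Laplacian $L$ of $(W_n)_\phi$ is the $n\times n$ integer matrix indexed by $v_1,\dots,v_n$ with $L_{ii}=3$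 and, for $i\ne j$, $L_{ij}=-1$ if $\{v_i,v_j\}$ is a positive edge, $L_{ij}=+1$ if $\{v_i,v_j\}$ is a negative edge, and $L_{ij}=0$ if $\{v_i,v_j\}$ is not an edge. The critical group is $\mathcal{K}((W_n)_\phi)=\mathbb{Z}^n/\mathrm{im}\,L$. $f_n$ is the $n$th Fibonacci number ($f_0=0$, $f_1=1$, $f_n=f_{n-1}+f_{n-2}$) and $\ell_n$ is the $n$th Lucas number ($\ell_0=2$, $\ell_1=1$, $\ell_n=\ell_{n-1}+\ell_{n-2}$). $\mathbb{Z}_k$ denotes $\mathbb{Z}/k\mathbb{Z}$.
   Formalization: ''Balanced'' is read as balance of the signed wheel with the hub (sink) deleted, i.e. of the rim cycle: with whole-wheel balance the claim is false, e.g. W_3 with a single negative spoke is unbalanced but its critical group is Z_4⊕Z_4, not Z_2⊕Z_10. *)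

(* Defs.v *)
From HB Require Import structures.
From mathcomp Require Import all_boot all_order all_algebra.
From mathcomp Require Import ring_quotient.
From mathcomp Require Import boolp.

Set Implicit Arguments.
Unset Strict Implicit.
Unset Printing Implicit Defensive.

Import GRing.Theory.

Record sgraph := SGraph {
  vertex :> finType;
  adj : rel vertex;
  adj_sym : symmetric adj;
  adj_irr : irreflexive adj }.

Definition edges (G : sgraph) : {set {set G}} :=
  [set [set p.1; p.2] | p : G * G & adj p.1 p.2].

(* [true] is the sign [-] and [false] the sign [+]; only the values on
   [edges G] are meaningful, so signings are compared on [edges G]. *)
Definition signing (G : sgraph) := {set G} -> bool.

Definition all_positive (G : sgraph) : signing G := fun=> false.

Definition switch (G : sgraph) (v : G) (phi : signing G) : signing G :=
  fun e => phi e (+) (v \in e).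

Definition switching_equiv (G : sgraph) (phi psi : signing G) :=
  exists s : seq G, {in edges G, foldr (@switch G) phi s =1 psi}.

Definition balanced (G : sgraph) (phi : signing G) :=
  switching_equiv phi (@all_positive G).

Section DeleteVertex.
Variables (G : sgraph) (q : G).

Definition del_adj : rel {x : G | x != q} := fun x y => adj (val x) (val y).

Lemma del_adj_sym : symmetric del_adj.
Proof. by move=> x y; apply: adj_sym. Qed.

Lemma del_adj_irr : irreflexive del_adj.
Proof. by move=> x; apply: adj_irr. Qed.

Definition del_vertex : sgraph := SGraph del_adj_sym del_adj_irr.

Definition del_signing (phi : signing G) : signing del_vertex :=
  fun e => phi [set val x | x in e].

End DeleteVertex.

Arguments del_signing {G} q phi.

(* Balance of a signed graph with sink [q].  The signs of the edges at the sink
   do not enter the reduced Laplacian, and balance is taken in the signed graph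
   [G - q].  It cannot be replaced by [balanced phi] in the computation of the
   critical groups of wheels: if the only negative edge of a signed W_3 is a
   spoke, then the signed graph is unbalanced, but its reduced Laplacian is the
   one of the all-positive W_3 = K_4, whose critical group is Z_4 + Z_4 and not
   Z_2 + Z_10.  The lemma below gives the implication which does hold. *)
Definition sink_balanced (G : sgraph) (q : G) (phi : signing G) :=
  balanced (del_signing q phi).

Arguments sink_balanced {G} q phi.

Lemma balanced_sink_balanced (G : sgraph) (q : G) (phi : signing G) :
  balanced phi -> sink_balanced q phi.
Proof.
case=> s sP; exists (pmap insub s) => e eE.
have qe : q \notin [set val x | x in e].
  by apply/imsetP => -[x _ qx]; have := valP x; rewrite -qx eqxx.
suff -> : foldr (@switch (del_vertex q)) (del_signing q phi) (pmap insub s) e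
          = foldr (@switch G) phi s [set val x | x in e].
  apply: sP; case/imsetP: eE => -[x y]; rewrite inE /= => xy ->.
  by apply/imsetP; exists (val x, val y); rewrite ?inE //= imsetU1 imset_set1.
elim: s {sP} => //= v s IHs; case: insubP => [u _ <-|] /=.
  by rewrite /switch IHs mem_imset //; apply: val_inj.
by rewrite negbK => /eqP ->; rewrite /switch (negPf qe) addbF.
Qed.

Section Wheel.
Variable n : nat.

(* [None] is the hub and [Some i] the rim vertex v_(i+1); [ordS] is the cyclic
   successor of 'I_n.  The condition [i != j] is redundant for n >= 2. *)
Definition wheel_adj : rel (option 'I_n) := fun x y =>
  match x, y with
  | Some i, Some j => (i != j) && ((j == ordS i) || (i == ordS j))
  | None, None => false
  | _, _ => true
  end.

Lemma wheel_adj_sym : symmetric wheel_adj.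
Proof. by case=> [i|] [j|] //=; rewrite eq_sym orbC. Qed.

Lemma wheel_adj_irr : irreflexive wheel_adj.
Proof. by case=> [i|] //=; rewrite eqxx. Qed.

Definition wheel : sgraph := SGraph wheel_adj_sym wheel_adj_irr.

Definition hub : wheel := None.
Definition rim (i : 'I_n) : wheel := Some i.

Local Open Scope ring_scope.

Definition wheel_laplacian (phi : signing wheel) : 'M[int]_n :=
  \matrix_(i, j)
    if i == j then 3
    else if adj (rim i) (rim j) then
      if phi [set rim i; rim j] then 1 else - 1
    else 0.

End Wheel.

Arguments hub {n}.

Local Open Scope ring_scope.

Definition im_mx n (L : 'M[int]_n) : {pred 'cV[int]_n} :=
  fun v => `[< exists x : 'cV[int]_n, v = L *m x >].

Lemma im_mx_zmod_closed n (L : 'M[int]_n) : zmod_closed (im_mx L).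
Proof.
split; first by apply/asboolP; exists 0; rewrite mulmx0.
move=> _ _ /asboolP[x ->] /asboolP[y ->].
by apply/asboolP; exists (x - y); rewrite mulmxBr.
Qed.

HB.instance Definition _ n (L : 'M[int]_n) :=
  GRing.isZmodClosed.Build 'cV[int]_n (im_mx L) (im_mx_zmod_closed L).

Definition coker n (L : 'M[int]_n) : zmodType := Quotient.quot (im_mx L).

Definition wheel_critical_group n (phi : signing (wheel n)) : zmodType :=
  coker (wheel_laplacian phi).

Definition zmod_iso (A B : zmodType) := exists f : {additive A -> B}, bijective f.

(* 'Z_k is Z/kZ only for k >= 2; this holds for all the moduli fib n, 5 * fib n
   and lucas n with n >= 3. *)
Definition Zsum (a b : nat) : zmodType := ('Z_a * 'Z_b)%type.

Fixpoint fib (n : nat) : nat :=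
  if n is m.+1 then (if m is k.+1 then (fib m + fib k)%N else 1%N) else 0%N.

Fixpoint lucas (n : nat) : nat :=
  if n is m.+1 then (if m is k.+1 then (lucas m + lucas k)%N else 1%N) else 2%N.

(* Main.v *)
From HB Require Import structures.
Require Import Defs.
From mathcomp Require Import all_boot all_order all_algebra.
From mathcomp Require Import ring_quotient boolp zify.

(** Let theta be the golden ratio and sigma the product of the signs of the rim
    edges. In the critical group the classes x_k of the rim vertices satisfy 3
    x_k = s_(k-1) x_(k-1) + s_k x_(k+1), where s_k is the sign of the k-th rim
    edge. Multiplying x_k by the product of the signs met on the way to it
    removes the signs: y_(k+2) = 3 y_(k+1) - y_k, with y_(k+n) = sigma y_k as
    the only trace of the signing. This is the recurrence of the powers of
    theta^2, so y_k = w_(2k) for a Fibonacci-like sequence w, and the critical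
    group is Z[theta] / (theta^(2n) - sigma), the vertex k being +-theta^(2k).

    Now theta^(2n) - sigma = theta^n (theta^n - sigma theta^(-n)), theta^n is a
    unit and theta^(-n) is (-1)^n times the conjugate of theta^n. So the ideal
    is generated by the trace lucas_n of theta^n if sigma = - (-1)^n, and by
    fib_n sqrt 5, the difference of theta^n and its conjugate, if sigma =
    (-1)^n. As sqrt 5 = 2 theta - 1 has elementary divisors 1 and 5 on Z[theta],
    the quotients are Z_lucas_n + Z_lucas_n and Z_fib_n + Z_(5 fib_n).

    The ring Z[theta] is replaced by Fibonacci-like sequences in an arbitrary
    abelian group A, on which theta acts as the shift. The factorization of
    theta^(2n) - sigma becomes fib_like_twisted, specialized in fib_like_lucas
    and fib_like_fib. It is used in both directions: in the target group it
    shows that the explicit sequence has the twisted period, so that it defines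
    a map out of the critical group (roll_harmonic); in the critical group it
    gives the relations which make this map injective (harmonic_unroll). The two
    are put together in wheel_critical_iso. Finally sigma = 1 is equivalent to
    balance of the rim, because each vertex lies on exactly two rim edges
    (sink_balanced_parity). *)

Set Implicit Arguments.
Unset Strict Implicit.
Unset Printing Implicit Defensive.

Import GRing.Theory.

Local Open Scope ring_scope.

(** * Fibonacci-like sequences in an abelian group *)

Section FibLike.
Variable A : zmodType.
Implicit Types (x y : A) (u w v : nat -> A).

Definition fib_like w := forall k, w k.+2 = w k.+1 + w k.

Lemma fib_like_eq u w : fib_like u -> fib_like w ->
  u 0 = w 0 -> u 1 = w 1 -> u =1 w.
Proof.
move=> uS wS e0 e1 k; suff [] : u k = w k /\ u k.+1 = w k.+1 by [].
by elim: k => // k [ek ek1]; split=> //; rewrite uS wS ek ek1.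
Qed.

(** The recurrence can be run backwards, so a tail determines the sequence. *)
Lemma fib_like_tail0 w m : fib_like w -> (forall k, w (k + m)%N = 0) ->
  forall k, w k = 0.
Proof.
move=> wS; elim: m => [w0 k|m IHm w0]; first by rewrite -[k]addn0.
apply: IHm => k.
by have := w0 k.+1; have := w0 k; rewrite addSn !addnS wS => ->; rewrite add0r.
Qed.

(** The solution starting with x, y; in this closed form it is visibly
    an integer combination of x and y with coefficients independent of A. *)
Definition gib x y (k : nat) : A :=
  if k is j.+1 then x *+ fib j + y *+ fib j.+1 else x.

Lemma gib1 x y : gib x y 1 = y.
Proof. by rewrite /gib mulr0n add0r mulr1n. Qed.

Lemma gib_fib_like x y : fib_like (gib x y).
Proof.
case=> [|k]; first by rewrite gib1 /gib /= !mulr1n addrC.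
by rewrite /gib (_ : fib k.+3 = fib k.+2 + fib k.+1)%N //
  (_ : fib k.+2 = fib k.+1 + fib k)%N // !mulrnDr addrACA.
Qed.

Lemma fib_like_scale (c : int) w :
  fib_like w -> fib_like (fun k => w k *~ c).
Proof. by move=> wS k; rewrite wS mulrzDl. Qed.

Lemma fib_like_scalen n w : fib_like w -> fib_like (fun k => w k *+ n).
Proof. by move=> wS k; rewrite wS mulrnDl. Qed.

Lemma fib_like_shift m w : fib_like w -> fib_like (fun k => w (k + m)%N).
Proof. by move=> wS k; rewrite !addSn wS. Qed.

(** The common form of the two classical identities
    w_(k+2n) + (-1)^n w_k = lucas_n w_(k+n)  and
    w_(k+2n) - (-1)^n w_k = fib_n (w_(k+n+1) + w_(k+n-1)):
    both sides satisfy the same two-step recurrence in n, with k moving along,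
    so that only n = 0 and n = 1 have to be compared. *)
Lemma fib_like_double w v (g : nat -> nat) (eps : int) :
    fib_like w ->
    (forall m, g m.+2 = (g m.+1 + g m)%N) ->
    (forall k, w k + w k *~ eps = v k *+ g 0) ->
    (forall k, w k.+2 - w k *~ eps = v k.+1 *+ g 1) ->
  forall n k, w (k + n.*2)%N + w k *~ (eps * (-1) ^+ n) = v (k + n)%N *+ g n.
Proof.
move=> wS gS base0 base1 n.
suff [] : (forall k, w (k + n.*2)%N + w k *~ (eps * (-1) ^+ n)
                     = v (k + n)%N *+ g n)
    /\ (forall k, w (k + n.+1.*2)%N + w k *~ (eps * (-1) ^+ n.+1)
                     = v (k + n.+1)%N *+ g n.+1) by [].
elim: n => [|n [IH0 IH1]]; split=> // k.
- by rewrite !addn0 mulr1.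
- by rewrite addn2 addn1 expr1 mulrN1 mulrNz base1.
rewrite gS mulrnDr.
transitivity (v (k.+1 + n.+1)%N *+ g n.+1 + v (k.+2 + n)%N *+ g n); last first.
  by rewrite !addSnnS.
rewrite -IH0 -IH1 !doubleS !addnS !addSn.
rewrite (wS (k + _).+2) wS !exprS !mulN1r opprK !mulrN !mulrNz.
rewrite (wS k) mulrzDl.
rewrite -[LHS]addrA -[RHS]addrA; congr (_ + _).
by rewrite [RHS]addrCA addKr.
Qed.

(** The twisted period says that the left-hand side of fib_like_double is zero,
    hence that g n kills a tail of v, hence all of v. *)
Lemma fib_like_twisted w v (g : nat -> nat) (eps : int) n :
    fib_like w -> fib_like v ->
    (forall m, g m.+2 = (g m.+1 + g m)%N) ->
    (forall k, w k + w k *~ eps = v k *+ g 0) ->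
    (forall k, w k.+2 - w k *~ eps = v k.+1 *+ g 1) ->
  (forall k, w (k + n.*2)%N = w k *~ (- (eps * (-1) ^+ n))) <->
  v 0 *+ g n = 0 /\ v 1 *+ g n = 0.
Proof.
move=> wS vS gS base0 base1; have D := fib_like_double wS gS base0 base1 n.
split=> [per | [v0 v1] k].
  suff v0 k : v k *+ g n = 0 by rewrite !v0.
  apply: (@fib_like_tail0 (fun k => v k *+ g n) n) => {k} [|k].
    exact: fib_like_scalen.
  by rewrite -D per mulrNz addNr.
apply/eqP; rewrite mulrNz -addr_eq0 D.
apply/eqP; apply: (@fib_like_eq (fun k => v k *+ g n) (fun=> 0)) => //.
  exact: fib_like_scalen.
by move=> j; rewrite addr0.
Qed.

Lemma fib_like_lucas w n : fib_like w ->
  (forall k, w (k + n.*2)%N = w k *~ (- (-1) ^+ n)) <->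
  w 0 *+ lucas n = 0 /\ w 1 *+ lucas n = 0.
Proof.
move=> wS; rewrite -[(-1) ^+ n]mul1r.
apply: fib_like_twisted => // k.
by rewrite wS mulr1z addrK.
Qed.

Lemma fib_like_fib w n : fib_like w ->
  (forall k, w (k + n.*2)%N = w k *~ (-1) ^+ n) <->
  (w 1 *+ 2 - w 0) *+ fib n = 0 /\ (w 1 + w 0 *+ 2) *+ fib n = 0.
Proof.
move=> wS; have -> : (-1) ^+ n = - (-1 * (-1) ^+ n) :> int.
  by rewrite mulN1r opprK.
have -> : w 1%N + w 0%N *+ 2 = w 2%N *+ 2 - w 1%N.
  by rewrite wS mulrnDl mulr2n addrAC addrK.
apply: (@fib_like_twisted _ (fun k => w k.+1 *+ 2 - w k)) => // k.
- by rewrite !wS mulrnDl opprD addrACA.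
- by rewrite mulrN1z subrr.
rewrite mulrN1z opprK mulr1n !wS mulrnDl [RHS]addrAC mulr2n addrK.
by rewrite mulr2n addrA.
Qed.

(** Fibonacci numbers with even index obey y_(k+2) = 3 y_(k+1) - y_k, so every
    solution of this recurrence is interpolated by a Fibonacci-like sequence,
    and the interpolation inherits a twisted period. *)
Lemma bisection (y : nat -> A) :
    (forall k, y k.+2 = y k.+1 *~ 3 - y k) ->
  forall k, y k = gib (y 0%N) (y 1%N - y 0%N) k.*2.
Proof.
move=> yS k; set w := gib _ _; have wS : fib_like w := gib_fib_like _ _.
suff [] : y k = w k.*2 /\ y k.+1 = w k.+1.*2 by [].
elim: k => [|k [e0 e1]]; split=> //.
  by rewrite [RHS](wS 0%N) [w 1]gib1 subrK.
rewrite yS e0 e1 !doubleS (wS k.*2.+2) (wS k.*2.+1).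
have -> : w k.*2 = w k.*2.+2 - w k.*2.+1 by rewrite wS addrAC subrr add0r.
move: (w k.*2.+2) (w k.*2.+1) => a b.
rewrite -[a *~ 3]pmulrn mulrSr mulr2n opprB.
by rewrite addrC -[a + a + a]addrA addrA subrK addrA [b + a]addrC.
Qed.

Lemma bisection_twisted (y : nat -> A) n (c : int) :
    (forall k, y k.+2 = y k.+1 *~ 3 - y k) ->
    (forall k, y (k + n)%N = y k *~ c) ->
  forall k, gib (y 0%N) (y 1%N - y 0%N) (k + n.*2)%N
            = gib (y 0%N) (y 1%N - y 0%N) k *~ c.
Proof.
move=> yS yn; set w := gib _ _; have wS : fib_like w := gib_fib_like _ _.
have yw k : y k = w k.*2 by apply: bisection.
apply: fib_like_eq; [exact: fib_like_shift | exact: fib_like_scale | |].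
  by rewrite -(yw n) -(yn 0%N).
by rewrite [w 1]gib1 mulrzBl -!yn !yw !add1n add0n doubleS wS addrK.
Qed.

End FibLike.

(** The integers P and Q are the same in all abelian groups; this is what
    transports relations from one group to another. *)
Lemma gib_sum (I : finType) (e : I -> nat) (m : I -> int) :
  exists P Q : int, forall (A : zmodType) (x y : A),
    \sum_i gib x y (e i) *~ m i = x *~ P + y *~ Q.
Proof.
exists (\sum_i gib 1 0 (e i) * m i), (\sum_i gib 0 1 (e i) * m i) => A x y.
rewrite !mulrz_sumr -big_split; apply: eq_bigr => i _ /=.
rewrite !mulrzA -mulrzDl; congr (_ *~ _).
case: (e i) => [|j]; first by rewrite /= mulr0z addr0 mulr1z.
by rewrite /gib !mul0rn addr0 add0r !mulrz_nat.
Qed.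

(** * Cokernels of integer matrices *)

Section Cokernel.
Variables (n : nat) (L : 'M[int]_n).

Lemma coker_eq0 (x : 'cV[int]_n) :
  (\pi_(coker L)%qT x == 0 :> coker L) = (x \in im_mx L).
Proof.
have -> : (0 : coker L) = \pi_(coker L)%qT 0 by rewrite raddf0.
by rewrite -Quotient.idealrBE subr0.
Qed.

Lemma coker_iso (B : zmodType) (f : {additive 'cV[int]_n -> B}) :
    (forall b, exists x, f x = b) ->
    (forall x, (f x == 0) = (x \in im_mx L)) ->
  zmod_iso (coker L) B.
Proof.
move=> fsurj fker.
have fpi x : f (repr (\pi_(coker L)%qT x)) = f x.
  apply/eqP; rewrite -subr_eq0 -raddfB fker -coker_eq0.
  by rewrite raddfB /= reprK subrr.
pose g (c : coker L) := f (repr c).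
have gB : zmod_morphism g.
  by move=> c d; rewrite -[c]reprK -[d]reprK -raddfB /g !fpi raddfB.
pose gA := GRing.isZmodMorphism.Build _ _ g gB.
pose G : {additive coker L -> B} := HB.pack g gA.
have Ginj : injective G.
  apply: raddf_inj => c /eqP; rewrite /= /g fker -coker_eq0 reprK.
  by move/eqP.
have Gsurj b : exists c, G c == b.
  by have [x <-] := fsurj b; exists (\pi_(coker L)%qT x); rewrite /= /g fpi.
exists G; exists (fun b => xchoose (Gsurj b)) => c; last first.
  exact/eqP/(xchooseP (Gsurj c)).
by apply: Ginj; apply/eqP/(xchooseP (Gsurj (G c))).
Qed.

Definition lincomb (B : zmodType) (H : 'I_n -> B) (x : 'cV[int]_n) : B :=
  \sum_i H i *~ x i 0.

Lemma lincomb_is_additive (B : zmodType) (H : 'I_n -> B) :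
  zmod_morphism (lincomb H).
Proof.
move=> x y; rewrite /lincomb -sumrB; apply: eq_bigr => i _.
by rewrite !mxE mulrzBr.
Qed.

HB.instance Definition _ (B : zmodType) (H : 'I_n -> B) :=
  GRing.isZmodMorphism.Build _ _ (lincomb H) (lincomb_is_additive H).

Lemma lincomb_delta (B : zmodType) (H : 'I_n -> B) j :
  lincomb H (delta_mx j 0) = H j.
Proof.
rewrite /lincomb (bigD1 j) //= big1 => [|i /negPf ij].
  by rewrite !mxE !eqxx mulr1z addr0.
by rewrite !mxE ij mulr0z.
Qed.

Lemma additive_lincomb (B : zmodType) (f : {additive 'cV[int]_n -> B}) x :
  f x = lincomb (fun i => f (delta_mx i 0)) x.
Proof.
rewrite [in LHS](matrix_sum_delta x) raddf_sum; apply: eq_bigr => i _.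
by rewrite big_ord1 -raddfMz -[_ *~ _]scaler_int intz.
Qed.

Lemma lincomb_mulmx (B : zmodType) (H : 'I_n -> B) (x : 'cV[int]_n) :
  lincomb H (L *m x) = lincomb (fun j => \sum_i H i *~ L i j) x.
Proof.
rewrite /lincomb; under eq_bigr do rewrite mxE mulrz_sumr.
rewrite exchange_big; apply: eq_bigr => j _; rewrite mulrz_suml.
by apply: eq_bigr => i _; rewrite mulrzA.
Qed.

End Cokernel.

(** * Harmonic functions on the rim of a signed wheel *)

Section SignedWheel.
Variables (n : nat) (n_gt2 : (2 < n)%N) (phi : signing (wheel n)).

Definition rim_ord (k : nat) : 'I_n :=
  Ordinal (ltn_pmod k (ltnW (ltnW n_gt2))).

Definition rim_neg (k : nat) : bool :=
  phi [set rim (rim_ord k); rim (rim_ord k.+1)].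

(** The parity of the number of negative edges met in k steps along the rim from
    its first vertex.  Switching the rim vertices of odd parity makes all
    rim edges positive, except that the cycle closes up with the sign
    (-1)^(rim_parity n). *)
Definition rim_parity (k : nat) : bool :=
  \big[addb/false]_(j < k) rim_neg j.

Local Notation v := rim_ord.
Local Notation s k := ((-1) ^+ rim_neg k : int).
Local Notation tau k := ((-1) ^+ rim_parity k : int).
Local Notation L := (wheel_laplacian phi).

Lemma rim_ord_val (i : 'I_n) : v i = i.
Proof. by apply: val_inj; rewrite /= modn_small. Qed.

Lemma rim_ordD k : v (k + n) = v k.
Proof. by apply: val_inj; rewrite /= modnDr. Qed.

Lemma ordS_rim_ord k : ordS (v k) = v k.+1.
Proof. by apply: val_inj; rewrite /= -addn1 modnDml addn1. Qed.

Lemma rim_ord_eqS k : (v k == v k.+1) = false.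
Proof.
rewrite -(inj_eq val_inj) /= -[X in (X %% _)%N == _]addn0 -addn1 eqn_modDl.
by rewrite mod0n modn_small // ltnW.
Qed.

Lemma rim_ord_eqSS k : (v k == v k.+2) = false.
Proof.
rewrite -(inj_eq val_inj) /= -[X in (X %% _)%N == _]addn0 -addn2 eqn_modDl.
by rewrite mod0n modn_small.
Qed.

Lemma rim_negD k : rim_neg (k + n) = rim_neg k.
Proof. by rewrite /rim_neg -addSn !rim_ordD. Qed.

Lemma rim_parityS k : rim_parity k.+1 = rim_parity k (+) rim_neg k.
Proof. by rewrite /rim_parity big_ord_recr. Qed.

Lemma rim_parityD k : rim_parity (k + n) = rim_parity k (+) rim_parity n.
Proof.
elim: k => [|k IHk]; first by rewrite [rim_parity 0]big_ord0.
by rewrite addSn !rim_parityS IHk rim_negD addbAC.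
Qed.

Lemma signrMM (A : zmodType) (x : A) (b : bool) :
  x *~ (-1) ^+ b *~ (-1) ^+ b = x.
Proof. by rewrite -mulrzA -signr_addb addbb. Qed.

Lemma tauS k : tau k.+1 = tau k * s k.
Proof. by rewrite rim_parityS signr_addb. Qed.

Lemma sum_wheel_laplacian (A : zmodType) (H : 'I_n -> A) k :
  \sum_i H i *~ L i (v k.+1) =
  H (v k.+1) *~ 3 - H (v k.+2) *~ s k.+1 - H (v k) *~ s k.
Proof.
have sgnE (b : bool) (x : A) : x *~ (if b then 1 else -1) = - (x *~ (-1) ^+ b).
  by rewrite -mulrNz; case: b; rewrite ?opprK.
rewrite (bigD1 (v k.+1)) //= -addrA; congr (_ + _).
  by rewrite mxE eqxx.
rewrite (bigD1 (v k.+2)) /=; last by rewrite eq_sym rim_ord_eqS.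
congr (_ + _).
  rewrite mxE eq_sym rim_ord_eqS /= eq_sym rim_ord_eqS /= !ordS_rim_ord eqxx.
  by rewrite orbT setUC sgnE.
rewrite (bigD1 (v k)) /=; last by rewrite rim_ord_eqS rim_ord_eqSS.
rewrite mxE rim_ord_eqS /= rim_ord_eqS /= !ordS_rim_ord eqxx /= sgnE.
rewrite big1 ?addr0 // => i /andP[/andP[i1 i2] i0].
rewrite mxE (negPf i1) /= i1 -!ordS_rim_ord.
rewrite (inj_eq (@ordS_inj n)) [v k == i]eq_sym (negPf i0).
by rewrite !ordS_rim_ord (negPf i2) mulr0z.
Qed.

(** The condition for mapping the i-th basis vector to H i to define a map out
    of the cokernel of the Laplacian. *)
Definition harmonic (A : zmodType) (H : 'I_n -> A) :=
  forall k, H (v k.+1) *~ 3 = H (v k.+2) *~ s k.+1 + H (v k) *~ s k.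

Lemma harmonicP (A : zmodType) (H : 'I_n -> A) :
  harmonic H <-> forall j, \sum_i H i *~ L i j = 0.
Proof.
split=> [hH j | hH k]; last first.
  have /eqP := hH (v k.+1); rewrite sum_wheel_laplacian -addrA -opprD subr_eq0.
  by move/eqP.
have -> : j = v (j + n.-1).+1.
  by rewrite -addnS prednK ?rim_ordD ?rim_ord_val // ltnW // ltnW.
by rewrite sum_wheel_laplacian hH addrAC addrK subrr.
Qed.

(** Unrolling a harmonic function along the universal cover of the rim, with
    the signs absorbed by the parities, leaves the recurrence of the
    all-positive wheel and a twisted period. *)
Lemma harmonic_unroll (A : zmodType) (H : 'I_n -> A) :
  harmonic H -> let y := fun k => H (v k) *~ tau k in
  (forall k, y k.+2 = y k.+1 *~ 3 - y k) /\
  (forall k, y (k + n)%N = y k *~ tau n).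
Proof.
move=> hH y; split=> k; last first.
  by rewrite /y rim_ordD rim_parityD signr_addb mulrzA.
apply/eqP; rewrite eq_sym subr_eq; apply/eqP.
rewrite /y mulrzAC hH mulrzDl; congr (_ + _).
  by rewrite [rim_parity k.+2]rim_parityS addbC signr_addb mulrzA.
by rewrite rim_parityS addbC signr_addb mulrzA signrMM.
Qed.

(** The twisted period is what makes the value at a rim vertex independent of
    the number of turns around the rim. *)
Lemma roll_harmonic (A : zmodType) (h : nat -> A) :
    fib_like h -> (forall k, h (k + n.*2)%N = h k *~ tau n) ->
  harmonic (fun i : 'I_n => h i.*2 *~ tau i).
Proof.
move=> hS hn; set H := fun i : 'I_n => _.
have HE k : H (v k) = h k.*2 *~ tau k.
  rewrite [in RHS](divn_eq k n) /H /=; elim: (k %/ n)%N => [|q IHq] //.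
  rewrite IHq mulSn [(n + _)%N]addnC addnAC (doubleD _ n) hn rim_parityD.
  by rewrite addbC signr_addb mulrzA signrMM.
move=> k; rewrite !HE [rim_parity k.+2]rim_parityS signr_addb mulrzA signrMM.
rewrite -[_ *~ tau k *~ s k]mulrzA -tauS mulrzAC -mulrzDl; congr (_ *~ _).
rewrite !doubleS (hS k.*2.+2) (hS k.*2.+1) -[_ *~ 3]pmulrn mulrS mulr2n.
by rewrite -!addrA; congr (_ + _); rewrite [RHS]addrCA -hS.
Qed.

(** The critical group is the group presented by two consecutive terms of a
    Fibonacci-like sequence subject to the twisted period.  The last hypothesis
    says that h0 and h1 satisfy no relations but those forced by the twisted
    period: it is applied with A the critical group itself, where the classes
    of the rim vertices form a harmonic function. *)
Lemma wheel_critical_iso (B : zmodType) (h0 h1 : B) :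
    (forall k, gib h0 h1 (k + n.*2)%N = gib h0 h1 k *~ tau n) ->
    (forall b, exists P Q : int, b = h0 *~ P + h1 *~ Q) ->
    (forall (A : zmodType) (w0 w1 : A),
       (forall k, gib w0 w1 (k + n.*2)%N = gib w0 w1 k *~ tau n) ->
       forall P Q : int, h0 *~ P + h1 *~ Q = 0 -> w0 *~ P + w1 *~ Q = 0) ->
  zmod_iso (wheel_critical_group phi) B.
Proof.
move=> hn gen univ; have hS := gib_fib_like h0 h1.
pose H (i : 'I_n) := gib h0 h1 i.*2 *~ tau i.
have Hharm : harmonic H by apply: roll_harmonic.
apply: (@coker_iso _ _ _ (lincomb H)) => [b | x].
  have [P [Q ->]] := gen b.
  have H0 : H (v 0) = h0.
    by rewrite /H /= mod0n /= /rim_parity big_ord0.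
  have H1 : H (v 1) *~ tau 1 - H (v 0) = h1.
    rewrite {}H0 /H /= modn_small ?signrMM; last exact: ltnW.
    by rewrite [gib _ _ _](hS 0%N) gib1 addrK.
  exists (delta_mx (v 0) 0 *~ P
          + (delta_mx (v 1) 0 *~ tau 1 - delta_mx (v 0) 0) *~ Q).
  by rewrite raddfD !raddfMz raddfB raddfMz /= !lincomb_delta H1 H0.
apply/eqP/idP => [fx0 | /asboolP[{}x ->]]; last first.
  rewrite /= lincomb_mulmx /lincomb big1 // => j _.
  by rewrite (proj1 (harmonicP H)) // mul0rz.
rewrite -coker_eq0; apply/eqP.
pose pi : {additive 'cV[int]_n -> coker L} := \pi_(coker L)%qT.
pose E (i : 'I_n) := pi (delta_mx i 0).
have Eharm : harmonic E.
  apply/harmonicP => j.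
  rewrite -[LHS](lincomb_delta (fun l => \sum_i E i *~ L i l) j) -lincomb_mulmx.
  rewrite -(additive_lincomb pi); apply/eqP; rewrite coker_eq0.
  by apply/asboolP; exists (delta_mx j 0).
have [] := harmonic_unroll Eharm; set y := fun k => E (v k) *~ tau k.
move=> yS yn; have yE := bisection yS; have wn := bisection_twisted yS yn.
have piE i : E i = gib (y 0) (y 1 - y 0) i.*2 *~ tau i.
  by rewrite -yE /y rim_ord_val signrMM.
(* The same P and Q express the class of x by the first two terms in the
   critical group, and the image of x by h0 and h1. *)
have [P [Q PQ]] := gib_sum (fun i : 'I_n => i.*2) (fun i => tau i * x i 0).
rewrite -[LHS]/(pi x) additive_lincomb.
rewrite (_ : lincomb _ x = (y 0) *~ P + (y 1 - y 0) *~ Q); last first.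
  rewrite -PQ; apply: eq_bigr => i _.
  by rewrite -/(E i) piE mulrzA.
apply: (univ _ _ _ wn).
by rewrite -PQ -[RHS]fx0; apply: eq_bigr => i _; rewrite mulrzA.
Qed.

End SignedWheel.

(** * The two possible critical groups *)

Lemma Zp_intr_eq0 a (m : int) : (1 < a)%N -> 1 *~ m = 0 :> 'Z_a ->
  exists q : int, m = a%:Z * q.
Proof.
move=> a_gt1; have natr0 (k : nat) : k%:R = 0 :> 'Z_a -> k = (a * (k %/ a))%N.
  move/(congr1 val); rewrite /= val_Zp_nat // => k0.
  by rewrite [LHS](divn_eq k a) k0 addn0 mulnC.
case: m => k; first by move/natr0 => ->; exists (k %/ a)%N%:Z; rewrite PoszM.
rewrite NegzE mulrNz => /eqP; rewrite oppr_eq0 => /eqP/natr0 ->.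
by exists (- (k.+1 %/ a)%N%:Z); rewrite PoszM mulrN.
Qed.

Lemma pair_mulrz (A B : zmodType) (x : A) (y : B) (m : int) :
  (x, y) *~ m = (x *~ m, y *~ m).
Proof.
have natE k : (x, y) *+ k = (x *+ k, y *+ k).
  by elim: k => // k IHk; rewrite !mulrS IHk.
by case: m => k; rewrite ?NegzE ?mulrNz -!pmulrn natE.
Qed.

Lemma pair_lin_eq0 (A B : zmodType) (x x' : A) (y y' : B) (P Q : int) :
  (x, y) *~ P + (x', y') *~ Q = 0 ->
  x *~ P + x' *~ Q = 0 /\ y *~ P + y' *~ Q = 0.
Proof. by rewrite !pair_mulrz => -[]. Qed.

Lemma fib_gt1 n : (2 < n)%N -> (1 < fib n)%N.
Proof.
case: n => [|[|[|n]]] // _; elim: n => // n IHn.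
by rewrite (_ : fib n.+4 = fib n.+3 + fib n.+2)%N // ltn_addr.
Qed.

Lemma lucas_gt1 n : (1 < n)%N -> (1 < lucas n)%N.
Proof.
case: n => [|[|n]] // _; elim: n => // n IHn.
by rewrite (_ : lucas n.+3 = lucas n.+2 + lucas n.+1)%N // ltn_addr.
Qed.

Section TwoGroups.
Variables (n : nat) (n_gt2 : (2 < n)%N) (phi : signing (wheel n)).

Lemma wheel_critical_lucas :
  rim_parity n_gt2 phi n = ~~ odd n ->
  zmod_iso (wheel_critical_group phi) (Zsum (lucas n) (lucas n)).
Proof.
move=> par; have l_gt1 := lucas_gt1 (ltnW n_gt2).
have sgn : (-1) ^+ rim_parity n_gt2 phi n = - (-1) ^+ n :> int.
  by rewrite par signrN signr_odd.
apply: (@wheel_critical_iso _ n_gt2 _ _ (1, 0) (0, 1)); rewrite ?sgn.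
- apply/(fib_like_lucas _ (gib_fib_like _ _)); rewrite gib1.
  rewrite !(pmulrn (_, _)) !pair_mulrz -!pmulrn !mul0rn.
  suff -> : (lucas n)%:R = 0 :> 'Z_(lucas n) by [].
  by apply: val_inj; rewrite /= val_Zp_nat // modnn.
- move=> [a b]; exists a, b; rewrite !pair_mulrz !mul0rz -!pmulrn !natr_Zp.
  by congr pair; rewrite /= ?addr0 ?add0r.
move=> A w0 w1 /(fib_like_lucas _ (gib_fib_like _ _)).
rewrite gib1 /= => -[z0 z1] P Q /pair_lin_eq0[].
rewrite !mul0rz addr0 add0r => /Zp_intr_eq0[] // p -> /Zp_intr_eq0[] // q ->.
by rewrite !mulrzA -!pmulrn z0 z1 !mul0rz addr0.
Qed.

(** Let theta be the golden ratio.  Sending 1 to (1, 2) and theta to (0, 1)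
    maps P + Q theta to (P, 2 P + Q), and P + Q theta is a multiple of fib_n (2 theta - 1) in Z[theta] iff fib_n
    divides P and 5 fib_n divides 2 P + Q. *)
Lemma wheel_critical_fib :
  rim_parity n_gt2 phi n = odd n ->
  zmod_iso (wheel_critical_group phi) (Zsum (fib n) (5 * fib n)).
Proof.
move=> par; have f_gt1 := fib_gt1 n_gt2.
have f5_gt1 : (1 < 5 * fib n)%N by rewrite (leq_trans f_gt1) // leq_pmull.
have sgn : (-1) ^+ rim_parity n_gt2 phi n = (-1) ^+ n :> int.
  by rewrite par signr_odd.
apply: (@wheel_critical_iso _ n_gt2 _ _ (1, 2%:R) (0, 1)); rewrite ?sgn.
- apply/(fib_like_fib _ (gib_fib_like _ _)); rewrite gib1.
  have f0 : (fib n)%:R = 0 :> 'Z_(fib n).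
    by apply: val_inj; rewrite /= val_Zp_nat // modnn.
  have f50 : (5 * fib n)%:R = 0 :> 'Z_(5 * fib n).
    by apply: val_inj; rewrite /= val_Zp_nat // modnn.
  rewrite !(pmulrn (_, _)) !pair_mulrz -!pmulrn.
  split; congr pair; rewrite /=.
  + by rewrite mul0rn sub0r mulNrn f0 oppr0.
  + by rewrite subrr mul0rn.
  + by rewrite add0r mulrnAC f0 mul0rn.
  by rewrite -mulrnA -mulrS -mulrnA f50.
- move=> [a b]; exists (a : nat)%:Z, ((b : nat)%:Z - (2 * a)%N%:Z).
  rewrite !pair_mulrz !mul0rz mulrzBr -!pmulrn !natr_Zp.
  by congr pair; rewrite /= ?addr0 // -mulrnA addrC subrK.
move=> A w0 w1 /(fib_like_fib _ (gib_fib_like _ _)).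
rewrite gib1 /= => -[z0 z1] P Q /pair_lin_eq0[].
rewrite mul0rz addr0 => /Zp_intr_eq0[] // p defP.
rewrite [2%:R]pmulrn -mulrzA -mulrzDr => /Zp_intr_eq0[] // q defQ.
have z5 : w1 *+ (5 * fib n) = 0.
  rewrite mulrnA (_ : w1 *+ 5 = (w1 *+ 2 - w0) *+ 2 + (w1 + w0 *+ 2)).
    by rewrite mulrnDl -!mulrnA ![(_ * fib n)%N]mulnC mulrnA z0 mul0rn z1 addr0.
  by rewrite mulrnBl -mulrnA [RHS]addrCA subrK -mulrS.
(* Q = (2 P + Q) - 2 P *)
have -> : Q = (5 * fib n)%N%:Z * q - 2 * P by rewrite -defQ addrC addKr.
rewrite mulrzBr !mulrzA -!pmulrn z5 mul0rz sub0r defP !mulrzA -!pmulrn.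
by rewrite -mulrzBl -mulrnBl -opprB mulNrn z0 oppr0 mul0rz.
Qed.

End TwoGroups.

(** * Balance on the rim *)

Lemma foldr_switch (G : sgraph) (phi : signing G) (r : seq G) (e : {set G}) :
  foldr (@switch G) phi r e = phi e (+) \big[addb/false]_(x <- r) (x \in e).
Proof.
elim: r => [|x r IHr] /=; first by rewrite big_nil addbF.
by rewrite /switch IHr big_cons -addbA [_ (+) (x \in e)]addbC.
Qed.

Section Balance.
Variables (n : nat) (n_gt2 : (2 < n)%N) (phi : signing (wheel n)).
Local Notation v := (rim_ord n_gt2).
Local Notation par := (rim_parity n_gt2 phi).

Lemma rim_not_hub (i : 'I_n) : rim i != hub. Proof. by []. Qed.

Definition rim_vertex (i : 'I_n) : del_vertex (@hub n) :=
  Sub (rim i) (rim_not_hub i).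

Definition rim_edge (k : nat) : {set del_vertex (@hub n)} :=
  [set rim_vertex (v k); rim_vertex (v k.+1)].

Lemma rim_vertexP (x : del_vertex (@hub n)) : exists i, x = rim_vertex i.
Proof. by case: x => -[i|//] xP; exists i; apply: val_inj. Qed.

Lemma rim_vertex_inj : injective rim_vertex.
Proof. by move=> i j /(congr1 val) []. Qed.

Lemma edges_delP (e : {set del_vertex (@hub n)}) :
  reflect (exists k, e = rim_edge k) (e \in edges (del_vertex (@hub n))).
Proof.
apply: (iffP imsetP) => [[[x y]] | [k ->]]; last first.
  exists (rim_vertex (v k), rim_vertex (v k.+1)) => //.
  by rewrite inE /= /del_adj /= rim_ord_eqS ordS_rim_ord eqxx.
have [i ->] := rim_vertexP x; have [j ->] := rim_vertexP y.
rewrite inE /= /del_adj /= => /andP[_ /orP[] /eqP-> ->].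
  by exists i; rewrite /rim_edge -ordS_rim_ord rim_ord_val.
by exists j; rewrite /rim_edge -ordS_rim_ord rim_ord_val setUC.
Qed.

Lemma del_signing_rim_edge k :
  del_signing hub phi (rim_edge k) = rim_neg n_gt2 phi k.
Proof. by rewrite /del_signing /rim_edge imsetU1 imset_set1. Qed.

(** Each rim vertex lies on exactly two rim edges. *)
Lemma rim_edge_parity (x : del_vertex (@hub n)) :
  \big[addb/false]_(k < n) (x \in rim_edge k) = false.
Proof.
have [j ->] := rim_vertexP x.
have mem_edge (k : 'I_n) :
    (rim_vertex j \in rim_edge k) = (k == j) (+) (k == ord_pred j).
  have ordS_neq : (k == ordS k) = false.
    by rewrite -(rim_ord_val n_gt2 k) ordS_rim_ord rim_ord_eqS.
  rewrite !inE !(inj_eq rim_vertex_inj) -ordS_rim_ord rim_ord_val.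
  rewrite -(can2_eq (@ordSK n) (@ord_predK n)) [j == k]eq_sym [j == _]eq_sym.
  by case: eqP => // <-; rewrite [ordS _ == _]eq_sym ordS_neq.
under eq_bigr do rewrite mem_edge.
rewrite big_split /= (bigD1 j) //= big1 => [|i /negPf//].
rewrite (bigD1 (ord_pred j)) //= big1 => [|i /negPf//].
by rewrite !eqxx.
Qed.

(** Switching a vertex does not change the parity of the number of negative rim
    edges.  If this parity is even, switching the vertices of odd rim_parity
    makes all rim edges positive. *)
Lemma sink_balanced_parity : sink_balanced hub phi <-> par n = false.
Proof.
split=> [[r rP] | par0].
  have: \big[addb/false]_(k < n)
          foldr (@switch _) (del_signing hub phi) r (rim_edge k) = false.
    by apply: big1 => k _; apply: rP; apply/edges_delP; exists k.
  under eq_bigr do rewrite foldr_switch del_signing_rim_edge.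
  rewrite big_split /= exchange_big /= [X in _ (+) X]big1 ?addbF // => x _.
  exact: rim_edge_parity.
pose odd_vertex (x : del_vertex (@hub n)) :=
  if val x is Some i then par (i : 'I_n) else false.
exists [seq x <- enum (del_vertex (@hub n)) | odd_vertex x].
move=> _ /edges_delP[k ->]; rewrite foldr_switch del_signing_rim_edge.
rewrite big_filter big_enum_cond /= /rim_edge big_mkcond /=.
have parv i : par (i %% n)%N = par i.
  rewrite [in RHS](divn_eq i n); elim: (i %/ n)%N => [|q IHq] //.
  by rewrite IHq mulSn -addnA [(n + _)%N]addnC rim_parityD par0 addbF.
rewrite (bigD1 (rim_vertex (v k))) //=.
rewrite (bigD1 (rim_vertex (v k.+1))) /=; last first.
  by rewrite (inj_eq rim_vertex_inj) eq_sym rim_ord_eqS.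
rewrite big1 => [|x /andP[x0 x1]]; last first.
  by rewrite !inE (negPf x0) (negPf x1) /=; case: ifP.
rewrite !inE !eqxx orbT /odd_vertex /= !parv rim_parityS /all_positive.
by case: (par k); case: (rim_neg _ _ k).
Qed.

End Balance.

(** For a prescribed parity, at most the first rim edge is negative. *)
Lemma rim_parity_surj n (n_gt2 : (2 < n)%N) (b : bool) :
  exists phi : signing (wheel n), rim_parity n_gt2 phi n = b.
Proof.
have n_gt0 : (0 < n)%N by exact: ltnW (ltnW _).
exists (fun e : {set wheel n} =>
  [&& b, rim (rim_ord n_gt2 0) \in e & rim (rim_ord n_gt2 1) \in e]).
rewrite /rim_parity (bigD1 (Ordinal n_gt0)) //= big1 ?addbF => [|k k0].
  by rewrite /rim_neg !inE !eqxx orbT /= andbT.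
have {}k0 : (0 < k)%N by rewrite lt0n.
rewrite /rim_neg !inE !(inj_eq (@Some_inj _)) -!(inj_eq val_inj) /=.
rewrite mod0n !(modn_small (ltn_ord k)) (modn_small (ltnW n_gt2)).
rewrite (ltn_eqF k0) /=.
have [kn|kn] := eqVneq k.+1 n.
  by rewrite kn modnn /= orbF; case: eqP; lia.
have k_small : (k.+1 < n)%N by rewrite ltn_neqAle kn ltn_ord.
by rewrite (modn_small k_small) andbF.
Qed.

Local Close Scope ring_scope.

Theorem theorem4p18 (n : nat) (hn : 3 <= n) :
  (forall phi : signing (wheel n),
    [/\ odd n -> ~ sink_balanced hub phi ->
          zmod_iso (wheel_critical_group phi) (Zsum (fib n) (5 * fib n)),
        ~~ odd n -> ~ sink_balanced hub phi ->
          zmod_iso (wheel_critical_group phi) (Zsum (lucas n) (lucas n)),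
        odd n -> sink_balanced hub phi ->
          zmod_iso (wheel_critical_group phi) (Zsum (lucas n) (lucas n)) &
        ~~ odd n -> sink_balanced hub phi ->
          zmod_iso (wheel_critical_group phi) (Zsum (fib n) (5 * fib n))]) /\
  [/\ forall phi : signing (wheel n),
        zmod_iso (wheel_critical_group phi) (Zsum (fib n) (5 * fib n)) \/
        zmod_iso (wheel_critical_group phi) (Zsum (lucas n) (lucas n)),
      exists phi : signing (wheel n),
        zmod_iso (wheel_critical_group phi) (Zsum (fib n) (5 * fib n)) &
      exists phi : signing (wheel n),
        zmod_iso (wheel_critical_group phi) (Zsum (lucas n) (lucas n))].
Proof.
have unbal (phi : signing (wheel n)) :
    ~ sink_balanced hub phi -> rim_parity hn phi n = true.
  by move=> nb; apply/negP => /negP/negbTE/(sink_balanced_parity hn)/nb.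
split=> [phi|].
  split=> [n_odd|/negbTE n_even|n_odd|/negbTE n_even] bal.
  - by apply: (@wheel_critical_fib _ hn); rewrite unbal.
  - by apply: (@wheel_critical_lucas _ hn); rewrite unbal // n_even.
  - apply: (@wheel_critical_lucas _ hn); rewrite n_odd.
    exact/sink_balanced_parity.
  - apply: (@wheel_critical_fib _ hn); rewrite n_even.
    exact/sink_balanced_parity.
split=> [phi||].
- have [p_odd|p_even] := eqVneq (rim_parity hn phi n) (odd n); [left|right].
    exact: (@wheel_critical_fib _ hn).
  apply: (@wheel_critical_lucas _ hn); move: p_even.
  by case: (rim_parity hn phi n); case: (odd n).
- have [phi phiP] := rim_parity_surj hn (odd n).
  by exists phi; apply: wheel_critical_fib phiP.
have [phi phiP] := rim_parity_surj hn (~~ odd n).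
by exists phi; apply: wheel_critical_lucas phiP.
Qed.
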